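(* Let $\mathfrak h$ be a nonnegative sesquilinear form in a complex Hilbert space $\mathfrak H$ with the representation $$\mathfrak h[\varphi,\psi]=(Q\varphi,Q\psi)_{\mathfrak K},\qquad\varphi,\psi\in\operatorname{dom}\mathfrak h=\operatorname{dom}Q,$$ where $Q$ is a linear operator from $\mathfrak H$ to a Hilbert space $\mathfrak K$. Let $K\in\mathbf B(\mathfrak K)$ be a nonnegative contraction and define forms $\mathfrak h_1,\mathfrak h_2$ in $\mathfrak H$ for all $\varphi,\psi\in\operatorname{dom}\mathfrak h=\operatorname{dom}Q$ by $$\mathfrak h_1[\varphi,\psi]=((I-K)^{1/2}Q\varphi,(I-K)^{1/2}Q\psi),\qquad\mathfrak h_2[\varphi,\psi]=(K^{1/2}Q\varphi,K^{1/2}Q\psi).\qquad( * )$$ Then $\mathfrak h$ has the sum decomposition $$\mathfrak h=\mathfrak h_1+\mathfrak h_2,\qquad\operatorname{dom}\mathfrak h=\operatorname{dom}\mathfrak h_1=\operatorname{dom}\mathfrak h_2,\qquad( ** )$$ where $\mathfrak h_1$ and $\mathfrak h_2$ are nonnegative. Conversely, let $\mathfrak h$ have a sum decomposition $( ** )$, where $\mathfrak h_1,\mathfrak h_2$ are nonnegative forms in $\mathfrak H$. Then there exists a nonnegative contraction $K\in\mathbf B(\mathfrak K)$ such that $( * )$ holds for all $\varphi,\psi\in\operatorname{dom}\mathfrak h$.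
   Context: A (sesquilinear) form $\mathfrak h$ in $\mathfrak H$ is a map $\operatorname{dom}\mathfrak h\times\operatorname{dom}\mathfrak h\to\mathbb C$, linear in the first and antilinear in the second entry, where $\operatorname{dom}\mathfrak h$ is a (not necessarily dense) linear subspace of $\mathfrak H$. It is nonnegative if $\mathfrak h[\varphi,\varphi]\ge0$ for all $\varphi\in\operatorname{dom}\mathfrak h$. The sum of two forms is defined pointwise on the intersection of their domains. $\mathbf B(\mathfrak K)$ denotes the bounded everywhere defined linear operators on $\mathfrak K$; a nonnegative contraction is a selfadjoint $K\in\mathbf B(\mathfrak K)$ with $0\le K\le I$. $Q$ is not assumed densely defined, closable, or with dense range. *)

(* Defs.v *)
From HB Require Import structures.
From mathcomp Require Import all_boot all_order all_algebra.
From mathcomp Require Import all_classical all_reals all_analysis.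
From mathcomp Require Import complex.

Set Implicit Arguments.
Unset Strict Implicit.
Unset Printing Implicit Defensive.

Import Order.TTheory GRing.Theory Num.Theory.
Import numFieldNormedType.Exports.

Local Open Scope classical_set_scope.
Local Open Scope ring_scope.

(* [inner] is linear in its first argument and antilinear in its second.
   Norms live in R[i], where 0 <= z means that z is real and nonnegative. *)
HB.mixin Record CompleteNormedModule_isHilbert (R : realType) H
    & CompleteNormedModule R[i] H := {
  inner : {dot H for @Num.conj R[i]} ;
  inner_norm : forall x : H, `|x| ^+ 2 = inner x x
}.

#[short(type="hilbertType")]
HB.structure Definition Hilbert (R : realType) :=
  { H of CompleteNormedModule R[i] H & CompleteNormedModule_isHilbert R H }.

Section bounded_operators.
Variables (R : realType) (H : hilbertType R).

Record bounded_op := BoundedOp {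
  bop :> {linear H -> H} ;
  bop_bounded : exists M : R[i], forall x, `|bop x| <= M * `|x|
}.

HB.instance Definition _ := Choice.copy bounded_op {classic bounded_op}.

Lemma id_sub_bounded (A : bounded_op) :
  exists M : R[i], forall x : H, `|(idfun \- A) x| <= M * `|x|.
Proof.
have [M AM] := bop_bounded A; exists (1 + M) => x.
by rewrite mulrDl mul1r (le_trans (ler_normB _ _))// lerD2l.
Qed.

Definition id_sub (A : bounded_op) : bounded_op :=
  @BoundedOp (idfun \- A) (id_sub_bounded A).

Definition selfadjoint (A : bounded_op) :=
  forall x y : H, inner (A x) y = inner x (A y).

Definition nonneg_op (A : bounded_op) :=
  selfadjoint A /\ forall x : H, 0 <= inner (A x) x.

Definition nonneg_contraction (A : bounded_op) :=
  selfadjoint A /\ forall x : H, 0 <= inner (A x) x <= inner x x.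

(* The nonnegative square root, chosen classically. A nonnegative bounded
   operator has exactly one, so the default value A is irrelevant for it. *)
Definition op_sqrt (A : bounded_op) : bounded_op :=
  xget A [set S : bounded_op | nonneg_op S /\ forall x, S (S x) = A x].

End bounded_operators.

Section partial_operators.
Variables (R : realType) (H K : hilbertType R).

(* A linear operator defined on a subspace; the values outside [odom] are
   meaningless. *)
Record linop := LinOp {
  odom : {pred H} ;
  oval :> H -> K ;
  odom_closed : submod_closed odom ;
  oval_linear : forall a : R[i],
    {in odom &, forall x y, oval (a *: x + y) = a *: oval x + oval y}
}.

Lemma op_comp_linear (S : bounded_op K) (Q : linop) (a : R[i]) :
  {in odom Q &,
    forall x y, S (Q (a *: x + y)) = a *: S (Q x) + S (Q y)}.
Proof. by move=> x y Dx Dy; rewrite oval_linear// linearP. Qed.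

Definition op_comp (S : bounded_op K) (Q : linop) : linop :=
  @LinOp (odom Q) (fun x => S (Q x)) (odom_closed Q) (@op_comp_linear S Q).

End partial_operators.

Section forms.
Variables (R : realType) (H : hilbertType R).

(* As for [linop], only the values on [fdom] are meaningful. *)
Record sform := SForm {
  fdom : {pred H} ;
  fval :> H -> H -> R[i] ;
  fdom_closed : submod_closed fdom ;
  fval_linearl : forall a : R[i], {in fdom & &,
    forall x y z, fval (a *: x + y) z = a * fval x z + fval y z} ;
  fval_linearr : forall a : R[i], {in fdom & &,
    forall x y z, fval z (a *: x + y) = Num.conj a * fval z x + fval z y}
}.

Definition form_eq (h h' : sform) :=
  fdom h =i fdom h' /\ {in fdom h &, forall x y, h x y = h' x y}.

Definition nonneg_form (h : sform) := {in fdom h, forall x, 0 <= h x x}.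

Section form_add.
Variables h h' : sform.

Let D : {pred H} := [predI fdom h & fdom h'].

Lemma form_add_closed : submod_closed D.
Proof.
have [h0 hD] := fdom_closed h; have [h'0 h'D] := fdom_closed h'.
split=> [|a x y]; first by rewrite inE /= h0 h'0.
by rewrite !inE => /andP[? ?] /andP[? ?]; apply/andP; split;
  [exact: hD | exact: h'D].
Qed.

Lemma form_add_linearl (a : R[i]) : {in D & &, forall x y z,
  h (a *: x + y) z + h' (a *: x + y) z
    = a * (h x z + h' x z) + (h y z + h' y z)}.
Proof.
move=> x y z /andP[? ?] /andP[? ?] /andP[? ?].
by rewrite !fval_linearl// mulrDr addrACA.
Qed.

Lemma form_add_linearr (a : R[i]) : {in D & &, forall x y z,
  h z (a *: x + y) + h' z (a *: x + y)
    = Num.conj a * (h z x + h' z x) + (h z y + h' z y)}.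
Proof.
move=> x y z /andP[? ?] /andP[? ?] /andP[? ?].
by rewrite !fval_linearr// mulrDr addrACA.
Qed.

Definition form_add : sform :=
  @SForm D (fun x y => h x y + h' x y)
    form_add_closed form_add_linearl form_add_linearr.

End form_add.

Definition sum_decomposition (h h1 h2 : sform) :=
  [/\ form_eq h (form_add h1 h2), fdom h =i fdom h1 & fdom h1 =i fdom h2].

End forms.

Section form_of_operator.
Variables (R : realType) (H K : hilbertType R) (Q : linop H K).

Lemma op_form_linearl (a : R[i]) : {in odom Q & &, forall x y z,
  inner (Q (a *: x + y)) (Q z) = a * inner (Q x) (Q z) + inner (Q y) (Q z)}.
Proof. by move=> x y z ? ? ?; rewrite oval_linear// linearPl. Qed.

Lemma op_form_linearr (a : R[i]) : {in odom Q & &, forall x y z,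
  inner (Q z) (Q (a *: x + y))
    = Num.conj a * inner (Q z) (Q x) + inner (Q z) (Q y)}.
Proof. by move=> x y z ? ? ?; rewrite oval_linear// linearPr. Qed.

Definition op_form : sform H :=
  @SForm R H (odom Q) (fun x y => inner (Q x) (Q y))
    (odom_closed Q) op_form_linearl op_form_linearr.

End form_of_operator.

(* Main.v *)
From HB Require Import structures.
Require Import Defs.
From mathcomp Require Import all_boot all_order all_algebra.
From mathcomp Require Import all_classical all_reals all_analysis.
From mathcomp Require Import complex ring lra.

Set Implicit Arguments.
Unset Strict Implicit.
Unset Printing Implicit Defensive.

Import Order.TTheory GRing.Theory Num.Theory.
Import numFieldNormedType.Exports.

Local Open Scope classical_set_scope.
Local Open Scope ring_scope.

(* Since (K^{1/2} u, K^{1/2} v) = (K u, v), the representation in the theorem says that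
   h_2[x, y] = (K Q x, Q y) and h_1[x, y] = ((I - K) Q x, Q y).

   Square roots: for a contraction B = I - A, the iteration
   Y_{n+1} = (B + Y_n^2) / 2 from Y_0 = 0 converges in norm, because each
   increment is dominated by that of the scalar iteration with B = 1. Its limit
   Y satisfies (I - Y)^2 = I - B = A.

   Converse: minimising |Q x|^2 - 2 Re l(x) represents every functional l with
   |l(x)| <= M |Q x| as l(x) = (Q x, v), with v in the closure of ran Q. Since
   h_2 <= h, the functional h_2[., x] gives a vector V x with |V x| <= |Q x|;
   then, for u in the whole space, the functional x |-> (V x, u) gives K u. In
   this way K is everywhere defined, and vanishes on the orthogonal complement of
   ran Q, without a prior extension to the closure of ran Q. *)

(** * Hermitian symmetry and the Cauchy-Schwarz inequality for nonnegative forms *)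

Section cauchy_schwarz.
Variables (R : realType) (H : hilbertType R) (f : sform H).
Hypothesis f_ge0 : nonneg_form f.

Lemma sform_expand (s : R[i]) : {in fdom f &, forall x y,
  f (s *: y + x) (s *: y + x) =
    f x x + (s * f y x + s^* * f x y) + `|s| ^+ 2 * f y y}.
Proof.
move=> x y Dx Dy.
have D : s *: y + x \in fdom f by exact: (fdom_closed f).2.
rewrite fval_linearl// !fval_linearr// normCK; ring.
Qed.

(** Positivity at s y + x makes s f(y, x) + s^* f(x, y) real for every s. The cases s = 1 and s = i
    together determine f(y, x). *)
Lemma sform_conj : {in fdom f &, forall x y, f y x = (f x y)^*}.
Proof.
move=> x y Dx Dy.
have real (s : R[i]) : (s * f y x + s^* * f x y) \is Num.real.
  have D : s *: y + x \in fdom f by exact: (fdom_closed f).2.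
  have /ger0_real := f_ge0 D; rewrite sform_expand// addrAC.
  rewrite rpredDl// rpredD// ?rpredM ?rpredX//; apply/ger0_real => //;
    by apply: f_ge0.
have /CrealP := real 1; have /CrealP := real 'i.
rewrite conjC1 !mul1r conjCi !rmorphD !rmorphM rmorphN /= conjCi opprK => ei e1.
set a := f x y in ei e1 *; set b := f y x in ei e1 *.
have : 'i * (2 * (a^* - b)) = 0.
  rewrite [X in _ = X](_ : _ = 'i * (b^* + a^* - (b + a)) -
      ('i * b + - 'i * a - (- 'i * b^* + 'i * a^*))).
    ring.
  by rewrite e1 -ei; ring.
move/eqP; rewrite mulf_eq0 (negPf (neq0Ci _)) /= mulf_eq0 pnatr_eq0 /= subr_eq0.
by move/eqP.
Qed.

(** Positivity at x - t f(x, y) y, for real t, gives a quadratic inequality in t. The choice t = 1 /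
    f(y, y) is optimal when f(y, y) is nonzero. *)
Lemma sform_CS : {in fdom f &, forall x y, `|f x y| ^+ 2 <= f x x * f y y}.
Proof.
move=> x y Dx Dy.
have q (t : R[i]) : t \is Num.real ->
    0 <= f x x - t * `|f x y| ^+ 2 *+ 2 + t ^+ 2 * `|f x y| ^+ 2 * f y y.
  move=> tr; set s := - (t * f x y).
  have D : s *: y + x \in fdom f by exact: (fdom_closed f).2.
  suff -> : f x x - t * `|f x y| ^+ 2 *+ 2 + t ^+ 2 * `|f x y| ^+ 2 * f y y
      = f (s *: y + x) (s *: y + x) by exact: f_ge0.
  rewrite sform_expand// (sform_conj Dx Dy) /s rmorphN rmorphM /= (CrealP tr).
  by rewrite normrN normrM exprMn [`|t| ^+ 2]normCK (CrealP tr) normCK; ring.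
have xx := f_ge0 Dx; have yy := f_ge0 Dy.
have c0 : 0 <= `|f x y| ^+ 2 by rewrite exprn_ge0.
have [y0|yN0] := eqVneq (f y y) 0; last first.
  have y_gt0 : 0 < f y y by rewrite lt_def yN0.
  have := q (f y y)^-1 (ger0_real _); rewrite invr_ge0 => /(_ yy).
  rewrite (_ : _ + _ = f x x - `|f x y| ^+ 2 / f y y); last by field.
  by rewrite subr_ge0 ler_pdivrMr.
have [c_eq0|cN0] := eqVneq (`|f x y| ^+ 2) 0; first by rewrite c_eq0 mulr_ge0.
(* With f(y, y) = 0 the inequality is affine in t, and this t turns its right side into - f(x, x) -
   2 < 0. *)
have := q ((f x x + 1) / `|f x y| ^+ 2) (ger0_real (divr_ge0 (addr_ge0 xx ler01) c0)).
rewrite y0 mulr0 addr0 divfK//.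
rewrite (_ : f x x - (f x x + 1) *+ 2 = - (f x x) - 2); last by ring.
by rewrite lt_geF// -opprD oppr_lt0 ltr_wpDl.
Qed.

End cauchy_schwarz.

(** * Inner product rules and norm bounds for contractions *)

Section inner_product.
Variables (R : realType) (H : hilbertType R).
Implicit Types x y : H.

Lemma predT_submod : submod_closed (predT : {pred H}).
Proof. by []. Qed.

Lemma linop_form_linearl (A : {linear H -> H}) (a : R[i]) :
  {in (predT : {pred H}) & &, forall x y z,
    inner (A (a *: x + y)) z = a * inner (A x) z + inner (A y) z}.
Proof. by move=> x y z _ _ _; rewrite linearP linearPl. Qed.

Lemma linop_form_linearr (A : {linear H -> H}) (a : R[i]) :
  {in (predT : {pred H}) & &, forall x y z,
    inner (A z) (a *: x + y) = Num.conj a * inner (A z) x + inner (A z) y}.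
Proof. by move=> x y z _ _ _; rewrite linearPr. Qed.

(** Makes [sform_CS] available both for the inner product itself (A the identity) and for (A x, y)
    with A nonnegative. *)
Definition linop_form (A : {linear H -> H}) : sform H :=
  SForm predT_submod (linop_form_linearl A) (linop_form_linearr A).

Lemma inner_ge0 x : 0 <= inner x x.
Proof. by rewrite -inner_norm exprn_ge0. Qed.

Lemma inner_conj x y : inner y x = (inner x y)^*.
Proof. by rewrite hermC/= expr0 mul1r. Qed.

Lemma innerPl a x y z : inner (a *: x + y) z = a * inner x z + inner y z.
Proof. exact: linearPl. Qed.

Lemma innerDl x y z : inner (x + y) z = inner x z + inner y z.
Proof. by have := innerPl 1 x y z; rewrite scale1r mul1r. Qed.

Lemma innerBl x y z : inner (x - y) z = inner x z - inner y z.
Proof. by have := innerPl (- 1) y x z; rewrite scaleN1r mulN1r !(addrC (- _)). Qed.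

Lemma innerZl a x y : inner (a *: x) y = a * inner x y.
Proof. by have := innerPl a x 0 y; rewrite innerDl linear0l !addr0. Qed.

Lemma innerDr x y z : inner x (y + z) = inner x y + inner x z.
Proof. by rewrite inner_conj innerDl rmorphD /= -!inner_conj. Qed.

Lemma innerBr x y z : inner x (y - z) = inner x y - inner x z.
Proof. by rewrite inner_conj innerBl rmorphB /= -!inner_conj. Qed.

Lemma innerZr a x y : inner x (a *: y) = a^* * inner x y.
Proof. by rewrite inner_conj innerZl rmorphM /= -!inner_conj. Qed.

Lemma inner_CS x y : `|inner x y| <= `|x| * `|y|.
Proof.
have := @sform_CS _ _ (linop_form idfun) (fun x _ => inner_ge0 x) x y isT isT.
by rewrite /= -!inner_norm -exprMn ler_pXn2r ?nnegrE ?mulr_ge0.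
Qed.

Lemma inner_eq0 x : inner x x = 0 -> x = 0.
Proof. by move/eqP; rewrite -inner_norm expf_eq0/= normr_eq0 => /eqP. Qed.

(** Cauchy-Schwarz for the form (A x, y) at x and A x gives |A x|^4 <= (A x, x) (A A x, A x) <=
    |x|^2 |A x|^2. *)
Lemma contraction_norm_le (A : bounded_op H) :
  nonneg_contraction A -> forall x, `|A x| <= `|x|.
Proof.
move=> [_ A01] x.
have A0 : nonneg_form (linop_form A) by move=> y _; case/andP: (A01 y).
have /= := sform_CS A0 (isT : x \in predT) (isT : A x \in predT).
rewrite -inner_norm normrX normr_id -exprM => le.
have [Ax0|AxN0] := eqVneq (A x) 0; first by rewrite Ax0 normr0.
have A2 : 0 < `|A x| ^+ 2 by rewrite exprn_gt0 ?normr_gt0.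
rewrite -(@ler_pXn2r _ 2) ?nnegrE// -(ler_pM2r A2) -exprD.
apply: le_trans le _; rewrite !inner_norm.
have /andP[x0 x1] := A01 x; have /andP[y0 y1] := A01 (A x).
exact: ler_pM.
Qed.

Lemma id_sub_contraction (A : bounded_op H) :
  nonneg_contraction A -> nonneg_contraction (id_sub A).
Proof.
move=> [As A01]; split=> [x y|x] /=.
  by rewrite linearBl/= linearBr/= As.
rewrite linearBl/= subr_ge0 gerBl.
by have /andP[-> ->] := A01 x.
Qed.

End inner_product.

(** * Limits expressed through error bounds M / (n + 1) *)

Section rates.
Variables (R : realType) (H : hilbertType R).

(** The Archimedean property, which replaces passage to the limit below: an identity or inequality
    is proved up to an error M / (n + 1). Reality of c is assumed because the order of [R[i]] is
    partial. *)
Lemma rate_le0 (c M : R[i]) : 0 <= M -> c \is Num.real ->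
  (forall n, c <= M / n.+1%:R) -> c <= 0.
Proof.
move=> M0 cr cM; case: (real_leP cr (real0 _)) => // c0.
have /complex_realP[r Mc] : M / c \is Num.real.
  by rewrite ger0_real// divr_ge0// ltW.
have := cM (Num.truncn r).
rewrite ler_pdivlMr// mulrC -ler_pdivlMr// Mc.
by rewrite -(rmorph_nat (real_complex R)) lecR leNgt truncnS_gt.
Qed.

Lemma rate_eq0 (V : normedZmodType R[i]) (x : V) (M : R[i]) : 0 <= M ->
  (forall n, `|x| <= M / n.+1%:R) -> x = 0.
Proof.
move=> M0 /(rate_le0 M0 (normr_real _)).
by rewrite normr_le0 => /eqP.
Qed.

Lemma rate_lt (M e : R[i]) : 0 <= M -> 0 < e -> exists n, M / n.+1%:R < e.
Proof.
move=> M0 e0; apply: contrapT => /forallNP N.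
suff : e <= 0 by rewrite lt_geF.
apply: (rate_le0 M0 (gtr0_real e0)) => n.
have Mn : M / n.+1%:R \is Num.real by rewrite ger0_real// divr_ge0.
by case: (real_leP (gtr0_real e0) Mn) => // /N.
Qed.

Lemma rate_cvg (u : nat -> H) (M : R[i]) : 0 <= M ->
    (forall n m, (n <= m)%N -> `|u m - u n| <= M / n.+1%:R) ->
  exists v, forall n, `|v - u n| <= M / n.+1%:R.
Proof.
move=> M0 uM.
have /cauchy_cvg/cvg_ex[v /cvgrPdist_le uv] : cauchy (u @ \oo).
  apply: cauchy_exP => e e0; have [n ne] := rate_lt M0 e0.
  exists (u n); exists n => // m /= nm.
  by rewrite -ball_normE /= distrC (le_lt_trans (uM _ _ nm)).
exists v => n; rewrite -subr_le0; apply: (rate_le0 ler01) => [|k].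
  by rewrite rpredB// ger0_real// divr_ge0.
have k0 : 0 < k.+1%:R^-1 :> R[i] by rewrite invr_gt0.
have [m _] := uv _ k0; move=> /(_ (maxn m n)) /(_ (leq_maxl _ _)) /= le.
rewrite lerBlDr mul1r -(subrK (u (maxn m n)) v) -addrA.
by rewrite (le_trans (ler_normD _ _))// lerD// uM// leq_maxr.
Qed.

End rates.

(** * Bounded operators from functions *)

Section bounded_linear.
Variables (R : realType) (H : hilbertType R).

Lemma bounded_opE (f : H -> H) (M : R[i]) : linear f ->
  (forall x, `|f x| <= M * `|x|) -> exists A : bounded_op H, A =1 f.
Proof.
move=> f_lin fM.
pose L : {linear H -> H} := HB.pack f (GRing.isLinear.Build _ _ _ _ f f_lin).
by exists (@BoundedOp _ _ L (ex_intro _ M fM)).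
Qed.

End bounded_linear.

(** * The scalar iteration that dominates the square root iteration *)

Section error_sequence.
Variable R : realType.

(* err n is 1 minus the n-th iterate of y |-> (1 + y^2) / 2 from 0. *)
Fixpoint err (n : nat) : R :=
  if n is m.+1 then err m - err m ^+ 2 / 2 else 1.

(** The map s - s^2 / 2 is increasing on [0, 1], and with t = n + 1 it sends 2 / (t + 1) to a value
    below 2 / (t + 2), the gap being 2 / ((t + 2) (t + 1)^2). *)
Lemma err_bounds n : 0 <= err n <= 1 /\ err n <= 2 / n.+2%:R.
Proof.
elim: n => [|n [/andP[e0 e1] e2]] /=; first by rewrite divff// lexx ler01.
split; first by apply/andP; split; nra.
set t : R := n.+1%:R; have t1 : 1 <= t by rewrite ler1n.
have nt : n.+2%:R = t + 1 by rewrite -natr1.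
have nt3 : n.+3%:R = t + 2 by rewrite -natr1 nt -addrA.
rewrite nt in e2; rewrite nt3.
have mono : err n - err n ^+ 2 / 2 <= 2 / (t + 1) - (2 / (t + 1)) ^+ 2 / 2.
  have : 2 / (t + 1) <= 1 by rewrite ler_pdivrMr; lra.
  by nra.
apply: le_trans mono _; rewrite -subr_ge0.
have -> : 2 / (t + 2) - (2 / (t + 1) - (2 / (t + 1)) ^+ 2 / 2)
  = 2 / ((t + 2) * (t + 1) ^+ 2).
  by field; apply/andP; split; lra.
by rewrite divr_ge0// mulr_ge0 ?sqr_ge0//; lra.
Qed.

Definition errC n : R[i] := (err n)%:C%C.

Lemma errCS n : errC n.+1 = errC n - errC n ^+ 2 / 2.
Proof. by rewrite /errC /= rmorphB rmorphM rmorphXn fmorphV rmorph_nat. Qed.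

Lemma errC_ge0 n : 0 <= errC n.
Proof. by have [/andP[e0 _] _] := err_bounds n; rewrite ler0c. Qed.

Lemma errC_le1 n : errC n <= 1.
Proof. by have [/andP[_ e1] _] := err_bounds n; rewrite lecR. Qed.

Lemma errC_rate n : errC n <= 2 / n.+1%:R.
Proof.
have [_ /le_trans le] := err_bounds n.
rewrite -!(rmorph_nat (real_complex R)) -fmorphV -rmorphM lecR.
by apply: le; rewrite ler_pM2l// lef_pV2 ?posrE// ler_nat.
Qed.

End error_sequence.

(** * The operator iteration and its rate of convergence *)

Section square_root.
Variables (R : realType) (H : hilbertType R) (B : bounded_op H).
Hypothesis B_contraction : nonneg_contraction B.

(* Converges to I - (I - B)^{1/2}. *)
Fixpoint sqrt_iter (n : nat) (x : H) : H :=
  if n is m.+1 then 2^-1 *: (B x + sqrt_iter m (sqrt_iter m x)) else 0.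

Local Notation Y := sqrt_iter.
Local Notation e := (errC R).

Lemma sqrt_iterS n x : Y n.+1 x = 2^-1 *: (B x + Y n (Y n x)).
Proof. by []. Qed.

Lemma sqrt_iter_linear n a x y : Y n (a *: x + y) = a *: Y n x + Y n y.
Proof.
elim: n a x y => [|n IH] a x y; first by rewrite /= scaler0 addr0.
rewrite !sqrt_iterS !IH linearP scalerA mulrC -scalerA -scalerDr.
by rewrite addrACA -scalerDr.
Qed.

Lemma sqrt_iterB n x y : Y n (x - y) = Y n x - Y n y.
Proof. by rewrite addrC -scaleN1r sqrt_iter_linear scaleN1r addrC. Qed.

Lemma sqrt_iter_sym n x y : inner (Y n x) y = inner x (Y n y).
Proof.
have [Bs _] := B_contraction.
elim: n x y => [|n IH] x y; first by rewrite linear0l linear0r.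
rewrite !sqrt_iterS innerZl innerZr innerDl innerDr !IH.
by rewrite fmorphV rmorph_nat [inner (B x) y]Bs.
Qed.

(** The factor 1 - e_n is the scalar iterate y_n, and the recursion carries the bound y_n to (1 +
    y_n^2) / 2 = y_{n+1}. *)
Lemma sqrt_iter_le n x : `|Y n x| <= (1 - e n) * `|x|.
Proof.
have B1 := contraction_norm_le B_contraction.
elim: n x => [|n IH] x; first by rewrite /= normr0 subrr mul0r.
rewrite sqrt_iterS normrZ gtr0_norm ?invr_gt0// ler_pdivrMl//.
apply: le_trans (ler_normD _ _) _.
have -> : 2 * ((1 - e n.+1) * `|x|) = `|x| + (1 - e n) * ((1 - e n) * `|x|).
  by rewrite errCS; field.
rewrite lerD ?B1// (le_trans (IH _))// ler_wpM2l ?IH//.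
by rewrite subr_ge0 errC_le1.
Qed.

(** Twice the next increment is Y_{n+1}^2 - Y_n^2 = Y_{n+1} (Y_{n+1} - Y_n) + (Y_{n+1} - Y_n) Y_n.
    The scalar increments satisfy the same identity, so the bounds propagate. *)
Lemma sqrt_iter_step n x : `|Y n.+1 x - Y n x| <= (e n - e n.+1) * `|x|.
Proof.
have B1 := contraction_norm_le B_contraction.
elim: n x => [|n IH] x.
  rewrite sqrt_iterS addr0 subr0 normrZ gtr0_norm ?invr_gt0// ler_pdivrMl//.
  rewrite errCS /errC /= expr1n (_ : 2 * _ = `|x|) ?B1//; by field.
rewrite sqrt_iterS [X in _ - X]sqrt_iterS -scalerBr.
rewrite normrZ gtr0_norm ?invr_gt0// ler_pdivrMl//.
rewrite opprD addrACA subrr add0r.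
rewrite -[X in `|X - _|](subrK (Y n.+1 (Y n x))) -sqrt_iterB -addrA.
have -> : 2 * ((e n.+1 - e n.+2) * `|x|) =
   (1 - e n.+1) * ((e n - e n.+1) * `|x|) + (e n - e n.+1) * ((1 - e n) * `|x|).
  by rewrite (errCS _ n.+1) !(errCS _ n); field.
apply: le_trans (ler_normD _ _) _; apply: lerD.
  apply: le_trans (sqrt_iter_le _ _) _; apply: ler_wpM2l (IH _).
  by rewrite subr_ge0 errC_le1.
apply: le_trans (IH _) _; apply: ler_wpM2l (sqrt_iter_le _ _).
by rewrite errCS subKr divr_ge0 ?exprn_ge0 ?errC_ge0.
Qed.

(** The increments telescope to e_n - e_m, which is at most e_n. *)
Lemma sqrt_iter_rate n m x : (n <= m)%N ->
  `|Y m x - Y n x| <= (2 * `|x|) / n.+1%:R.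
Proof.
move=> nm; apply: (@le_trans _ _ ((e n - e m) * `|x|)).
  elim: m nm => [|m IH]; first by rewrite leqn0 => /eqP->; rewrite !subrr normr0 mul0r.
  rewrite leq_eqVlt => /predU1P[->|/IH{}IH]; first by rewrite !subrr normr0 mul0r.
  rewrite -(subrK (Y m x) (Y m.+1 x)) -addrA (le_trans (ler_normD _ _))//.
  have -> : e n - e m.+1 = (e m - e m.+1) + (e n - e m) by ring.
  by rewrite mulrDl lerD// sqrt_iter_step.
rewrite mulrAC ler_wpM2r// (le_trans _ (errC_rate _ n))// gerBl.
exact: errC_ge0.
Qed.

End square_root.

(** * Existence of the nonnegative square root *)

Section square_root_existence.
Variables (R : realType) (H : hilbertType R).

Lemma bounded_sqrt_exists (A : bounded_op H) : nonneg_contraction A ->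
  exists S : bounded_op H, nonneg_op S /\ forall x, S (S x) = A x.
Proof.
move=> /id_sub_contraction hB; set B := id_sub A in hB.
have M0 (x : H) : 0 <= 2 * `|x| by rewrite mulr_ge0.
have [Y YP] := choice (fun x =>
  rate_cvg (M0 x) (fun n m => @sqrt_iter_rate _ _ _ hB n m x)).
have Ylin a x y : Y (a *: x + y) = a *: Y x + Y y.
  apply/eqP; rewrite -subr_eq0; apply/eqP.
  apply: (@rate_eq0 _ _ _ (2 * `|a *: x + y| + (`|a| * (2 * `|x|) + 2 * `|y|))).
    by rewrite !addr_ge0 ?mulr_ge0.
  move=> n; have -> : Y (a *: x + y) - (a *: Y x + Y y) =
      (Y (a *: x + y) - sqrt_iter B n (a *: x + y))
      - (a *: (Y x - sqrt_iter B n x) + (Y y - sqrt_iter B n y)).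
    rewrite sqrt_iter_linear scalerBr addrACA -opprD.
    by rewrite opprB addrA subrK.
  rewrite (le_trans (ler_normB _ _))// mulrDl lerD// (le_trans (ler_normD _ _))//.
  by rewrite mulrDl lerD// normrZ -mulrA ler_wpM2l.
have Y1 x : `|Y x| <= `|x|.
  rewrite -subr_le0; apply: (rate_le0 (M0 x)) => [|n].
    by rewrite rpredB ?normr_real.
  rewrite lerBlDr -(subrK (sqrt_iter B n x) (Y x)).
  rewrite (le_trans (ler_normD _ _))// lerD//.
  rewrite (le_trans (sqrt_iter_le hB _ _))// ler_piMl// gerBl.
  exact: errC_ge0.
have Ysym x y : inner (Y x) y = inner x (Y y).
  apply/eqP; rewrite -subr_eq0; apply/eqP.
  apply: (@rate_eq0 _ _ _ (2 * `|x| * `|y| + `|x| * (2 * `|y|))).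
    by rewrite addr_ge0 ?mulr_ge0.
  move=> n; have -> : inner (Y x) y - inner x (Y y) =
      inner (Y x - sqrt_iter B n x) y - inner x (Y y - sqrt_iter B n y).
    by rewrite innerBl innerBr (sqrt_iter_sym hB) opprB addrA subrK.
  rewrite (le_trans (ler_normB _ _))// mulrDl lerD//.
    by rewrite (le_trans (inner_CS _ _))// mulrAC ler_wpM2r.
  by rewrite (le_trans (inner_CS _ _))// -mulrA ler_wpM2l.
(* The recursion in the limit, Y^2 = 2 Y - B. The error splits into three terms since B + Y_n^2 is 2
   Y_{n+1}. *)
have YY x : Y (Y x) = Y x *+ 2 - B x.
  apply/eqP; rewrite -subr_eq0; apply/eqP.
  apply: (@rate_eq0 _ _ _ (2 * `|Y x| + 2 * `|x| + 2 * (2 * `|x|))).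
    by rewrite !addr_ge0 ?mulr_ge0.
  move=> n; have -> : Y (Y x) - (Y x *+ 2 - B x) =
      (Y (Y x) - sqrt_iter B n (Y x)) + sqrt_iter B n (Y x - sqrt_iter B n x)
       - 2 *: (Y x - sqrt_iter B n.+1 x).
    rewrite sqrt_iterS scalerBr scalerA divff// scale1r sqrt_iterB scaler_nat.
    by rewrite subrKA !opprB [B x + _]addrC -[_ + B x - _]addrA subrKA.
  rewrite (le_trans (ler_normB _ _))// mulrDl lerD//.
    rewrite (le_trans (ler_normD _ _))// mulrDl lerD//.
    rewrite (le_trans (sqrt_iter_le hB _ _))// (le_trans (ler_piMl _ _) (YP _ _))//.
    by rewrite gerBl errC_ge0.
  rewrite normrZ ger0_norm// -mulrA ler_wpM2l// (le_trans (YP _ _))//.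
  by rewrite ler_wpM2l// lef_pV2 ?posrE// ler_nat.
have [S SE] : exists S : bounded_op H, S =1 (fun x => x - Y x).
  apply: (@bounded_opE _ _ _ 2) => [a x y|x].
    by rewrite Ylin opprD addrACA scalerBr.
  by rewrite (le_trans (ler_normB _ _))// mulr_natl mulr2n lerD.
exists S; split; last first.
  move=> x; have YB : Y (x - Y x) = B x - Y x.
    have := Ylin (- 1) (Y x) x; rewrite !scaleN1r (addrC _ x) => ->.
    by rewrite YY mulr2n -[X in - X]addrA opprD addrAC addNr add0r opprB.
  by rewrite !SE YB opprB addrA subrK [B x]/= subKr.
split=> [x y|x]; first by rewrite !SE innerBl innerBr Ysym.
(* Positivity of I - Y: (Y x, x) is real and at most |Y x| |x| <= |x|^2. *)
rewrite SE innerBl subr_ge0 -inner_norm.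
have Yr : inner (Y x) x \is Num.real by rewrite CrealE -inner_conj Ysym.
rewrite (le_trans (real_ler_norm Yr))// (le_trans (inner_CS _ _))//.
by rewrite expr2 ler_wpM2r.
Qed.

Lemma op_sqrtP (A : bounded_op H) : nonneg_contraction A ->
  nonneg_op (op_sqrt A) /\ forall x, op_sqrt A (op_sqrt A x) = A x.
Proof. by move=> /bounded_sqrt_exists; exact: xgetPex. Qed.

End square_root_existence.

(** * Riesz representation on the closure of the range of Q *)

Section riesz.
Variables (R : realType) (H K : hilbertType R) (Q : linop H K).
Variables (l : H -> R[i]) (M : R[i]).
Hypothesis M_ge0 : 0 <= M.
Hypothesis l_linear : forall a : R[i],
  {in odom Q &, forall x y, l (a *: x + y) = a * l x + l y}.
Hypothesis l_bound : {in odom Q, forall x, `|l x| <= M * `|Q x|}.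

(** If l(x) = (Q x, v), then G(x) = |Q x - v|^2 - |v|^2, so minimising G makes Q x approach v. *)
Let G x := inner (Q x) (Q x) - (l x + (l x)^*).

(** The first variation: 2 Re (s D(x, y)) is the part of G(s y + x) - G(x) of first order in s. *)
Let D x y := inner (Q y) (Q x) - l y.

Let odomP a : {in odom Q &, forall x y, a *: x + y \in odom Q}.
Proof. by move=> x y Dx Dy; apply: (odom_closed Q).2. Qed.

Let odom0 : 0 \in odom Q.
Proof. exact: (odom_closed Q).1. Qed.

Let energy_expand (s : R[i]) : {in odom Q &, forall x y,
  G (s *: y + x) =
    G x + (s * D x y + s^* * (D x y)^*) + `|s| ^+ 2 * inner (Q y) (Q y)}.
Proof.
move=> x y Dx Dy; rewrite /G /D oval_linear// l_linear//.
rewrite !(innerDl, innerDr, innerZl, innerZr) !rmorphD !rmorphM rmorphN /= normCK.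
rewrite [inner (Q x) (Q y)]inner_conj; ring.
Qed.

Let energy_real x : G x \is Num.real.
Proof.
rewrite rpredB//; first by rewrite ger0_real ?inner_ge0.
by rewrite CrealE rmorphD /= conjCK addrC.
Qed.

(** Completing the square: G(x) >= |Q x|^2 - 2 M |Q x| >= - M^2. *)
Let energy_lower : {in odom Q, forall x, - M ^+ 2 <= G x}.
Proof.
move=> x Dx; rewrite /G -inner_norm.
have lr : l x + (l x)^* \is Num.real by rewrite CrealE rmorphD /= conjCK addrC.
have : l x + (l x)^* <= M * `|Q x| *+ 2.
  rewrite (le_trans (real_ler_norm lr))// (le_trans (ler_normD _ _))//.
  by rewrite norm_conjC mulr2n lerD// l_bound.
move=> lM; rewrite -subr_ge0 opprK -addrA.
apply: (@le_trans _ _ ((`|Q x| - M) ^+ 2)).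
  by rewrite real_exprn_even_ge0// rpredB ?ger0_real.
rewrite sqrrB [`|Q x| * M]mulrC -addrA lerD2l [X in _ <= X]addrC.
by rewrite addrC lerD2l lerN2.
Qed.

(** The values of G are real, so the infimum is taken in [R] and embedded back into [R[i]]. *)
Let energy_inf : exists m : R[i], {in odom Q, forall x, m <= G x} /\
  forall e, 0 < e -> exists2 x, x \in odom Q & G x < m + e.
Proof.
pose E := [set r : R | exists2 x, x \in odom Q & r%:C%C = G x].
have EG x : x \in odom Q -> E (complex.Re (G x)).
  by move=> Dx; exists x => //; rewrite RRe_real.
have lbE : lbound E (complex.Re (- M ^+ 2)).
  move=> r [x Dx rG]; rewrite -lecR rG RRe_real ?energy_lower//.
  by rewrite rpredN rpredX// ger0_real.
have E_inf : has_inf E.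
  by split; [exists (complex.Re (G 0)); exact: EG|exists (complex.Re (- M ^+ 2))].
exists (inf E)%:C%C; split=> [x Dx|e e0].
  by rewrite -(RRe_real (energy_real x)) lecR ge_inf//; [case: E_inf|exact: EG].
have er : (complex.Re e)%:C%C = e by rewrite RRe_real// gtr0_real.
have e0' : 0 < complex.Re e by rewrite -ltcR er.
have [r [x Dx rG] re] := inf_adherent e0' E_inf.
by exists x => //; rewrite -rG -er -rmorphD ltcR.
Qed.

(** The slack is a square so that the parallelogram estimate gives |Q u_k - Q u_n| <= 2 / (n + 1)
    for k >= n, the form that [rate_cvg] takes. *)
Let energy_minimizing : exists (m : R[i]) (u : nat -> H),
  [/\ {in odom Q, forall x, m <= G x}, forall n, u n \in odom Q &
      forall n, G (u n) <= m + n.+1%:R^-1 ^+ 2].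
Proof.
have [m [mG ex]] := energy_inf.
have ex' n : exists x, x \in odom Q /\ G x <= m + n.+1%:R^-1 ^+ 2.
  have e0 : 0 < n.+1%:R^-1 ^+ 2 :> R[i] by rewrite exprn_gt0// invr_gt0.
  by have [x Dx /ltW ?] := ex _ e0; exists x.
have [u uP] := choice ex'.
by exists m, u; split=> // n; have [] := uP n.
Qed.

(* Parallelogram law: the energy at the midpoint of x and y is at least m. *)
Let energy_gap (m : R[i]) : {in odom Q, forall x, m <= G x} ->
  {in odom Q &, forall x y,
    `|Q y - Q x| ^+ 2 <= 2 * ((G x - m) + (G y - m))}.
Proof.
move=> mG x y Dx Dy.
have Dd : y - x \in odom Q by rewrite addrC -scaleN1r odomP.
have Qd : Q (y - x) = Q y - Q x.
  by rewrite addrC -scaleN1r oval_linear// scaleN1r addrC.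
have := mG _ (odomP 2^-1 Dd Dx).
have := energy_expand 1 Dx Dd; rewrite scale1r subrK => Gy.
rewrite (energy_expand 2^-1 Dx Dd) => le.
rewrite inner_norm -Qd -subr_ge0.
set A := D x _ in Gy le; set q := inner _ _ in Gy le *.
rewrite conjC1 normr1 expr1n !mul1r in Gy.
rewrite fmorphV rmorph_nat ger0_norm ?invr_ge0// in le.
have -> : 2 * (G x - m + (G y - m)) - q =
    4 * ((G x + (2^-1 * A + 2^-1 * A^*) + 2^-1 ^+ 2 * q) - m).
  by rewrite Gy; field.
by rewrite mulr_ge0// subr_ge0.
Qed.

Lemma riesz : exists v, [/\ closure (Q @` [set` odom Q]) v, `|v| <= M &
  {in odom Q, forall x, l x = inner (Q x) v}].
Proof.
have [m [u [mG Du Gu]]] := energy_minimizing.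
have u_cauchy n k : (n <= k)%N -> `|Q (u k) - Q (u n)| <= 2 / n.+1%:R.
  move=> nk; rewrite -(@ler_pXn2r _ 2) ?nnegrE ?divr_ge0//.
  rewrite (le_trans (energy_gap mG (Du n) (Du k)))// exprMn.
  rewrite (_ : 2 ^+ 2 = 2 * 2 :> R[i])// -mulrA ler_wpM2l// mulr_natl mulr2n.
  rewrite lerD// lerBlDl ?Gu// (le_trans (Gu _))// lerD2l.
  by rewrite ler_pXn2r ?nnegrE ?invr_ge0// lef_pV2 ?posrE// ler_nat.
have [v uv] := rate_cvg (ler0n _ 2) u_cauchy.
have lv : {in odom Q, forall y, l y = inner (Q y) v}.
  move=> y Dy; apply/eqP; rewrite eq_sym -subr_eq0; apply/eqP.
  set A := _ - _; set q := inner (Q y) (Q y).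
  have q0 : 0 <= q := inner_ge0 _.
  have qr : q \is Num.real by rewrite ger0_real.
  have cc_real (z : R[i]) : z + z^* \is Num.real.
    by rewrite CrealE rmorphD /= conjCK addrC.
  (* Limit of m <= G(s y + u_n): there D(u_n, y) tends to A and G(u_n) to m. In the constant, 1
     bounds the slack of G(u_n), and the rest bounds 2 Re (s d). *)
  have variation (s : R[i]) : - (s * A + s^* * A^* + `|s| ^+ 2 * q) <= 0.
    apply: (@rate_le0 _ _ (1 + 2 * (`|s| * (`|Q y| * 2)))) => [||n].
    - by rewrite addr_ge0 ?mulr_ge0.
    - have := cc_real (s * A); rewrite rmorphM /= realN => /realD; apply.
      by rewrite realM ?realX ?normr_real.
    pose d := inner (Q y) (Q (u n) - v).
    have DA : D (u n) y = A + d by rewrite /D /A /d innerBr; ring.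
    have dn : `|s * d| <= `|s| * (`|Q y| * 2) / n.+1%:R.
      rewrite normrM -mulrA ler_wpM2l// (le_trans (inner_CS _ _))// -mulrA.
      by rewrite ler_wpM2l// distrC.
    have := mG _ (odomP s Dy (Du n)); rewrite energy_expand// DA -/q => le.
    have le2 : 0 <= (n.+1%:R^-1 ^+ 2 + (s * d + (s * d)^*)) -
        (- (s * A + s^* * A^* + `|s| ^+ 2 * q)).
      have := le_trans le (lerD (lerD (Gu n) (lexx _)) (lexx _)).
      rewrite -subr_ge0 => /le_trans; apply.
      rewrite le_eqVlt; apply/orP; left; apply/eqP.
      by rewrite rmorphD rmorphM /=; ring.
    rewrite subr_ge0 in le2; apply: le_trans le2 _.
    rewrite mulrDl lerD//.
      rewrite mul1r expr2 ler_piMl ?invr_ge0// invf_le1 ?ler1n//.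
    rewrite (le_trans (real_ler_norm (cc_real _)))//.
    rewrite (le_trans (ler_normD _ _))// norm_conjC -mulrA mulr_natl mulr2n.
    by rewrite lerD.
  have q1 : 0 < q + 1 by rewrite ltr_wpDl.
  (* This s turns the inequality into |A|^2 (q + 2) / (q + 1)^2 <= 0. Dividing by q + 1 covers q = 0
     as well. *)
  have := variation (- ((q + 1)^-1 * A^*)).
  have t_real : (q + 1)^-1^* = (q + 1)^-1 by apply/CrealP; rewrite gtr0_real ?invr_gt0.
  rewrite normrN normrM norm_conjC rmorphN rmorphM /= conjCK t_real.
  rewrite [`|_^-1|]ger0_norm ?invr_ge0 ?(ltW q1)//.
  rewrite exprMn normCK.
  rewrite (_ : - _ = A * A^* * ((q + 2) / (q + 1) ^+ 2)); last first.
    by field; rewrite gt_eqF.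
  rewrite pmulr_lle0; last by rewrite divr_gt0 ?exprn_gt0// ltr_wpDl.
  rewrite -normCK => A0; apply/eqP; rewrite -normr_le0.
  by rewrite -(@ler_pXn2r _ 2) ?nnegrE// expr0n.
exists v; split=> //.
- move=> B /nbhs_ballP[e /= e0 eB].
  have [n ne] := rate_lt (ler0n _ 2) e0.
  exists (Q (u n)); split; first by exists (u n) => //=; exact: Du.
  by apply: eB; rewrite -ball_normE /= (le_lt_trans (uv n)).
(* The inner product (v, v) is the limit of (Q u_n, v) = l(u_n), which is at most M |Q u_n| in
   modulus. *)
have vM : `|v| * `|v| <= M * `|v|.
  rewrite -subr_le0; apply: (@rate_le0 _ _ (2 * `|v| + M * 2)).
  - by rewrite addr_ge0 ?mulr_ge0.
  - by rewrite rpredB ?rpredM ?normr_real ?ger0_real.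
  move=> n; rewrite lerBlDr -expr2 inner_norm -[leLHS]ger0_norm ?inner_ge0//.
  rewrite -{1}(subrK (Q (u n)) v) innerDl -lv// (le_trans (ler_normD _ _))//.
  rewrite mulrDl -addrA lerD//.
    by rewrite (le_trans (inner_CS _ _))// mulrAC ler_wpM2r.
  rewrite (le_trans (l_bound (Du n)))// -mulrA -mulrDr ler_wpM2l//.
  by rewrite -[Q (u n)](subrK v) (le_trans (ler_normD _ _))// lerD2r distrC.
have [->|v0] := eqVneq v 0; first by rewrite normr0.
by rewrite -(ler_pM2r (_ : 0 < `|v|)) ?normr_gt0.
Qed.

End riesz.

(** * The operator of a nonnegative form dominated by |Q x|^2 *)

Section form_operator.
Variables (R : realType) (H K : hilbertType R) (Q : linop H K).
Let cl := closure (Q @` [set` odom Q]).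

Let cl_approx v n : cl v ->
  exists2 x, x \in odom Q & `|v - Q x| <= n.+1%:R^-1.
Proof.
move=> clv; have n0 : 0 < n.+1%:R^-1 :> R[i] by rewrite invr_gt0.
have [_ [[x Dx <-]]] := clv _ (nbhsx_ballx v _ n0).
by rewrite -ball_normE => /ltW; exists x.
Qed.

Let cl_orth v z : cl v -> {in odom Q, forall x, inner (Q x) z = 0} ->
  inner v z = 0.
Proof.
move=> clv Qz; apply: (@rate_eq0 _ _ _ `|z|) => // n.
have [x Dx vx] := cl_approx n clv.
rewrite -[v](subrK (Q x)) innerDl Qz// addr0 (le_trans (inner_CS _ _))//.
by rewrite mulrC ler_wpM2l.
Qed.

(** The difference p - (a q + r) is orthogonal to ran Q, hence to each of p, q, r, hence to itself.
    This yields linearity of all maps obtained from [riesz]. *)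
Let cl_comb a p q r : cl p -> cl q -> cl r ->
  {in odom Q, forall x,
    inner (Q x) p = a^* * inner (Q x) q + inner (Q x) r} -> p = a *: q + r.
Proof.
move=> clp clq clr E; apply/eqP; rewrite -subr_eq0; apply/eqP/inner_eq0.
have Oz : {in odom Q, forall x, inner (Q x) (p - (a *: q + r)) = 0}.
  by move=> x Dx; rewrite innerBr innerDr innerZr E// subrr.
by rewrite innerBl innerDl innerZl !cl_orth// mulr0 addr0 subr0.
Qed.

Let cl_inj p q : cl p -> cl q ->
  {in odom Q, forall x, inner (Q x) p = inner (Q x) q} -> p = q.
Proof.
move=> clp clq E; rewrite (@cl_comb 0 p p q)// ?scale0r ?add0r// => x Dx.
by rewrite conjC0 mul0r add0r E.
Qed.

Lemma form_operator (g : sform H) : fdom g =i odom Q -> nonneg_form g ->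
    {in odom Q, forall x, g x x <= inner (Q x) (Q x)} ->
  exists T : bounded_op K, nonneg_contraction T /\
    {in odom Q &, forall x y, g x y = inner (T (Q x)) (Q y)}.
Proof.
move=> gQ g0 gle.
have Dg x : x \in odom Q -> x \in fdom g by rewrite gQ.
have g_bound : {in odom Q &, forall x y, `|g x y| <= `|Q y| * `|Q x|}.
  move=> x y Dx Dy; rewrite -(@ler_pXn2r _ 2) ?nnegrE ?mulr_ge0// exprMn.
  rewrite (le_trans (sform_CS g0 (Dg _ Dx) (Dg _ Dy)))// !inner_norm mulrC.
  by rewrite ler_pM ?gle ?g0 ?Dg.
(* The domain condition sits under the existential, so choice yields a total V, with arbitrary
   values outside [odom Q]. *)
have exV y : exists v, y \in odom Q -> [/\ cl v, `|v| <= `|Q y| &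
    {in odom Q, forall x, g x y = inner (Q x) v}].
  have [Dy|] := boolP (y \in odom Q); last by exists 0.
  have [|a x z Dx Dz|x Dx|v vP] := @riesz _ _ _ Q (g ^~ y) `|Q y|.
  - by [].
  - by rewrite fval_linearl// Dg.
  - exact: g_bound.
  by exists v.
have [V VP] := choice exV.
have Vcl x : x \in odom Q -> cl (V x) by move=> /VP[].
have VQ x : x \in odom Q -> `|V x| <= `|Q x| by move=> /VP[].
have gV : {in odom Q &, forall x y, g x y = inner (Q x) (V y)}.
  by move=> x y Dx /VP[_ _]; apply.
(* V is linear because g and the inner product are both antilinear in the second entry. *)
have Vlin a : {in odom Q &, forall x y, V (a *: x + y) = a *: V x + V y}.
  move=> x y Dx Dy; have Dxy : a *: x + y \in odom Q by exact: (odom_closed Q).2.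
  apply: cl_comb; [exact: Vcl..|move=> z Dz].
  by rewrite -!gV// fval_linearr// Dg.
have exT u : exists w, [/\ cl w, `|w| <= `|u| &
    {in odom Q, forall x, inner (V x) u = inner (Q x) w}].
  apply: riesz => // [a x y Dx Dy|x Dx].
    by rewrite Vlin// innerDl innerZl.
  by rewrite (le_trans (inner_CS _ _))// mulrC ler_wpM2l// VQ.
have [t tP] := choice exT.
have tcl u : cl (t u) by have [] := tP u.
have t_le u : `|t u| <= `|u| by have [] := tP u.
have Vt u : {in odom Q, forall x, inner (V x) u = inner (Q x) (t u)}.
  by have [] := tP u.
have tlin a u w : t (a *: u + w) = a *: t u + t w.
  by apply: cl_comb => // x Dx; rewrite -!Vt// innerDr innerZr.
have tB u w : t (u - w) = t u - t w.
  by have := tlin (- 1) w u; rewrite !scaleN1r !(addrC (- _)).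
(* By the symmetry of g: (Q y, t Q x) = (V y, Q x) = g(y, x) = (Q y, V x). *)
have tQ x : x \in odom Q -> t (Q x) = V x.
  move=> Dx; apply: cl_inj => //; first exact: Vcl.
  move=> y Dy; rewrite -Vt// -gV// (sform_conj g0 (Dg _ Dx) (Dg _ Dy)) gV//.
  by rewrite -inner_conj.
(* P is the orthogonal projection onto the closure of ran Q. Since V takes values in that closure, t
   = t P. *)
have exP u : exists w, [/\ cl w, `|w| <= `|u| &
    {in odom Q, forall x, inner (Q x) u = inner (Q x) w}].
  apply: riesz => // [a x y Dx Dy|x Dx].
    by rewrite oval_linear// innerDl innerZl.
  by rewrite mulrC inner_CS.
have [P PP] := choice exP.
have Pcl u : cl (P u) by have [] := PP u.
have clP v u : cl v -> inner v u = inner v (P u).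
  move=> clv; apply/eqP; rewrite -subr_eq0 -innerBr; apply/eqP.
  apply: cl_orth => // x Dx; have [_ _ QP] := PP u.
  by rewrite innerBr QP// subrr.
have tP' u : t u = t (P u).
  apply: cl_inj => // x Dx; rewrite -!Vt//; exact/clP/Vcl.
(* Symmetry is proved first against ran Q, then by approximation against its closure, and finally
   against every vector through P. *)
have t_symQ u x : x \in odom Q -> inner (t u) (Q x) = inner u (t (Q x)).
  by move=> Dx; rewrite inner_conj -Vt// -inner_conj tQ.
have t_symcl u v : cl v -> inner (t u) v = inner u (t v).
  move=> clv; apply/eqP; rewrite -subr_eq0; apply/eqP.
  apply: (@rate_eq0 _ _ _ (2 * `|u|)) => [|n]; first by rewrite mulr_ge0.
  have [x Dx vx] := cl_approx n clv.
  have -> : inner (t u) v - inner u (t v) =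
      inner (t u) (v - Q x) - inner u (t (v - Q x)).
    by rewrite tB !innerBr t_symQ// opprB addrA subrK.
  rewrite (le_trans (ler_normB _ _))// -mulrA mulr_natl mulr2n.
  by rewrite lerD// (le_trans (inner_CS _ _))// ler_pM// (le_trans (t_le _)).
have t_sym u w : inner (t u) w = inner u (t w).
  by rewrite (tP' w) -t_symcl// -clP.
have t_real u : inner (t u) u \is Num.real by rewrite CrealE -inner_conj t_sym.
have t_ge0cl v : cl v -> 0 <= inner (t v) v.
  (* On ran Q, (t Q x, Q x) = g(x, x) >= 0. Replacing v by Q x costs |v| / (n + 1) in one entry and
     |Q x| / (n + 1) <= (|v| + 1) / (n + 1) in the other. *)
  move=> clv; rewrite -oppr_le0; apply: (@rate_le0 _ _ (2 * `|v| + 1)).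
  - by rewrite addr_ge0 ?mulr_ge0.
  - by rewrite realN.
  move=> n; have [x Dx vx] := cl_approx n clv.
  have x0 : 0 <= inner (t (Q x)) (Q x).
    by rewrite t_sym tQ// -gV// g0 ?Dg.
  have Qx : `|Q x| <= `|v| + 1.
    rewrite -[Q x](subKr v) (le_trans (ler_normB _ _))// lerD2l.
    by rewrite (le_trans vx)// invf_le1// ler1n.
  apply: (@le_trans _ _ (inner (t (Q x)) (Q x) - inner (t v) v)).
    by rewrite lerDr.
  have -> : inner (t (Q x)) (Q x) - inner (t v) v =
      - (inner (t (v - Q x)) v + inner (t (Q x)) (v - Q x)).
    by rewrite tB innerBl innerBr subrKA opprB.
  have real : inner (t (v - Q x)) v + inner (t (Q x)) (v - Q x) \is Num.real.
    by rewrite tB innerBl innerBr subrKA realB.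
  rewrite (le_trans (real_ler_norm _))// ?realN// normrN.
  rewrite (le_trans (ler_normD _ _))//.
  rewrite (_ : 2 * `|v| + 1 = `|v| + (`|v| + 1)); last by ring.
  rewrite mulrDl lerD// (le_trans (inner_CS _ _))// ?[`|t _| * `|v|]mulrC.
    by rewrite ler_wpM2l// (le_trans (t_le _)).
  by rewrite ler_pM// (le_trans (t_le _)).
have [T TE] : exists T : bounded_op K, T =1 t.
  by apply: (@bounded_opE _ _ _ 1) => // u; rewrite mul1r.
exists T; split; last by move=> x y Dx Dy; rewrite TE t_sym tQ// gV.
split=> [u w|u]; rewrite !TE; first exact: t_sym.
apply/andP; split.
  by rewrite tP' clP// t_ge0cl.
rewrite (le_trans (real_ler_norm (t_real _)))//.
by rewrite (le_trans (inner_CS _ _))// -inner_norm expr2 ler_wpM2r.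
Qed.

End form_operator.

(** * The two directions of the sum decomposition *)

Lemma op_sqrt_inner (R : realType) (H : hilbertType R) (A : bounded_op H)
    (x y : H) : nonneg_contraction A ->
  inner (op_sqrt A x) (op_sqrt A y) = inner (A x) y.
Proof. by move=> /op_sqrtP[[S_sym _] SS]; rewrite -S_sym SS. Qed.

Theorem theorem4p1 (R : realType) (HH KK : hilbertType R)
    (h : sform HH) (Q : linop HH KK)
    (h_ge0 : nonneg_form h) (hQ : form_eq h (op_form Q)) :
  (forall K : bounded_op KK, nonneg_contraction K ->
     let h1 := op_form (op_comp (op_sqrt (id_sub K)) Q) in
     let h2 := op_form (op_comp (op_sqrt K) Q) in
     [/\ sum_decomposition h h1 h2, nonneg_form h1 & nonneg_form h2])
  /\
  (forall h1 h2 : sform HH, nonneg_form h1 -> nonneg_form h2 ->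
     sum_decomposition h h1 h2 ->
     exists K : bounded_op KK,
       [/\ nonneg_contraction K,
           form_eq h1 (op_form (op_comp (op_sqrt (id_sub K)) Q))
         & form_eq h2 (op_form (op_comp (op_sqrt K) Q))]).
Proof.
have [hD hE] := hQ.
split=> [K hK|h1 h2 h1_ge0 h2_ge0 [[_ h12] hh1 h1h2]].
  split=> [|x _|x _]; [|exact: inner_ge0..].
  split=> //; split=> [x|x y Dx Dy].
    by rewrite hD [RHS]inE /= andbb.
  rewrite hE// [LHS]/= [RHS]/= !op_sqrt_inner//; last exact: id_sub_contraction.
  by rewrite innerBl subrK.
have h2D : fdom h2 =i odom Q by move=> x; rewrite -h1h2 -hh1 hD.
have h1D : fdom h1 =i odom Q by move=> x; rewrite h1h2.
have sumE : {in odom Q &, forall x y, inner (Q x) (Q y) = h1 x y + h2 x y}.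
  move=> x y Dx Dy; have <- : h x y = inner (Q x) (Q y) by rewrite hE ?hD.
  by rewrite h12 ?hD.
(* Nonnegativity of h1 gives h2 <= h, so K can be built from h2 alone; the formula for h1 then
   follows by subtraction. *)
have h2_le : {in odom Q, forall x, h2 x x <= inner (Q x) (Q x)}.
  by move=> x Dx; rewrite sumE// lerDr h1_ge0// h1D.
have [K [hK KE]] := form_operator h2D h2_ge0 h2_le.
exists K; split=> //; split=> // x y; rewrite ?h1D ?h2D => Dx Dy.
  rewrite /= op_sqrt_inner; last exact: id_sub_contraction.
  by rewrite innerBl -KE// sumE// addrK.
by rewrite /= op_sqrt_inner// KE.
Qed.
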